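(* Let $\alpha\in(0,1/2)$, let $\mathbf{v}\in\mathbb{R}^n$ be a stochastic vector and $\mathscr{P}$ an $n\times n\times n$ stochastic tensor, and set $\mathbf{a}=(1-\alpha)\mathbf{v}$, $\mathscr{B}=\alpha\mathscr{P}$. Let $\mathbf{m}$ be the minimal nonnegative solution of $\mathbf{x}=\mathbf{a}+\mathscr{B}\mathbf{x}^2$ and assume $\mathbf{m}>\mathbf{0}$. Let $\tilde{\mathscr{B}}=(\tilde b_{ijk})$ be a nonnegative $n\times n\times n$ tensor and $\tilde{\mathbf{a}}\in\mathbb{R}^n$ a nonnegative vector with $\sum_i\tilde b_{ijk}=\sum_i b_{ijk}$ for all $j,k$ and $\sum_i\tilde a_i=\sum_i a_i$. Suppose that $d(\tilde{\mathscr{B}},\mathscr{B})\le\varepsilon$ and $d(\tilde{\mathbf{a}},\mathbf{a})\le\varepsilon$ for an $0<\varepsilon<1$ small enough to ensure $$(1+\varepsilon)\,\rho(I_n-R_{\mathbf{m}})<1\qquad\text{and}\qquad\varepsilon+\varepsilon^2<\frac{1}{4\gamma^2\omega^2},$$ where $\gamma=\frac{(1+\varepsilon)^{n-1}}{(1-\varepsilon)^n}$ and $\omega=\max_{m_i\neq0}\frac{z_i}{m_i}$ with $\mathbf{z}=S^T\mathbf{m}$, $S$ being the matrix $S=S(R_{\mathbf{m}}^T)$ defined in the context. Then the perturbed equation $\tilde{\mathbf{x}}=\tilde{\mathbf{a}}+\tilde{\mathscr{B}}\tilde{\mathbf{x}}^2$ has a solution $\tilde{\mathbf{m}}$ such that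 $$d(\tilde{\mathbf{m}},\mathbf{m})\le2\omega\gamma\varepsilon.$$
   Context: Inequalities between vectors are componentwise. A stochastic vector has nonnegative entries summing to $1$; a stochastic tensor $\mathscr{P}=(p_{ijk})$ has $p_{ijk}\ge0$ and $\sum_{i}p_{ijk}=1$ for all $j,k$. For an $n\times n\times n$ tensor $\mathscr{B}$, $(\mathscr{B}\mathbf{x}^2)_i=\sum_{j,k}b_{ijk}x_jx_k$. The matrix $R_{\mathbf{x}}$ has entries $(R_{\mathbf{x}})_{ij}=\delta_{ij}-\sum_{k}(b_{ikj}+b_{ijk})x_k$. The minimal nonnegative solution is the solution $\mathbf{m}\ge\mathbf{0}$ with $\mathbf{m}\le\mathbf{x}$ for every solution $\mathbf{x}\ge\mathbf{0}$; here it is known to exist and to satisfy $\mathbf{1}_n^T\mathbf{m}=1$, so that $R_{\mathbf{m}}^T$ is a nonsingular M-matrix with $R_{\mathbf{m}}^T\mathbf{1}_n=(1-2\alpha)\mathbf{1}_n$. $\rho(\cdot)$ is the spectral radius. For arrays of the same shape, $d(\tilde A,A)=\max|\tilde a-a|/|a|$ over corresponding entries, with $0/0=0$ and $b/0=\infty$ for $b\ne0$. Definition of $S(M)$: for an invertible $M\in\mathbb{R}^{n\times n}$ with nonpositive off-diagonal entries, put weights $w_{ij}=-M_{ij}$ for $i\ne j$ in $\{1,\dots,n\}$, and let $$\zeta_l=\frac{1}{\det M}\sum_{\mathcal{T}}\ \prod_{(i,j)\in\mathcal{T}}w_{ij},\qquad l=1,\dots,n,$$ where the sum is over all spanning trees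 $\mathcal{T}$ of the complete directed graph on nodes $\{1,\dots,n\}$ in which all edges are oriented towards node $l$ (for $n=1$ the sum equals $1$). Then $M^{-1}=R(M)+S(M)$ with $R(M)=\mathbf{1}_n\boldsymbol{\zeta}^T$ and $S(M)=M^{-1}-\mathbf{1}_n\boldsymbol{\zeta}^T$. *)

(* Defs.v *)
From HB Require Import structures.
From mathcomp Require Import all_boot all_order all_algebra.
From mathcomp Require Import all_classical all_reals.
From mathcomp Require Import complex.

Set Implicit Arguments.
Unset Strict Implicit.
Unset Printing Implicit Defensive.
Import Order.TTheory GRing.Theory Num.Theory.
Local Open Scope ring_scope.

Section Definitions.
Variable R : realType.

Definition tensor n := 'I_n -> 'I_n -> 'I_n -> R.

Definition le_vec n (x y : 'cV[R]_n) := forall i, x i 0 <= y i 0.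
Definition lt_vec n (x y : 'cV[R]_n) := forall i, x i 0 < y i 0.
Definition nneg_tensor n (B : tensor n) := forall i j k, 0 <= B i j k.

Definition stochastic_vector n (v : 'cV[R]_n) :=
  le_vec 0 v /\ \sum_i v i 0 = 1.
Definition stochastic_tensor n (P : tensor n) :=
  nneg_tensor P /\ forall j k, \sum_i P i j k = 1.

Definition scale_tensor n (c : R) (P : tensor n) : tensor n :=
  fun i j k => c * P i j k.

Definition tensor_sq n (B : tensor n) (x : 'cV[R]_n) : 'cV[R]_n :=
  \col_i \sum_j \sum_k B i j k * x j 0 * x k 0.

Definition is_solution n (a : 'cV[R]_n) (B : tensor n) (x : 'cV[R]_n) :=
  x = a + tensor_sq B x.

Definition is_minimal_nneg_solution n (a : 'cV[R]_n) (B : tensor n)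
    (m : 'cV[R]_n) :=
  [/\ le_vec 0 m, is_solution a B m
    & forall x, le_vec 0 x -> is_solution a B x -> le_vec m x].

Definition Rmat n (B : tensor n) (x : 'cV[R]_n) : 'M[R]_n :=
  \matrix_(i, j) ((i == j)%:R - \sum_k (B i k j + B i j k) * x k 0).

(* Largest modulus of a complex eigenvalue; the supremum is a maximum as soon
   as 0 < n, the set being then finite and nonempty. *)
Definition spectral_radius n (A : 'M[R]_n) : R :=
  sup [set Normc.normc l | l in
        [set l : R[i] | eigenvalue (map_mx (real_complex R) A) l]]%classic.

(* In \bar R, 0^-1 = +oo, 0 * +oo = 0 and x * +oo = +oo for 0 < x, which are
   the conventions 0/0 = 0 and b/0 = oo. *)
Definition rel_err (b a : R) : \bar R := (`|b - a|%:E / `|a|%:E)%E.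

Definition dist_vec n (b a : 'cV[R]_n) : \bar R :=
  \big[maxe/-oo%E]_(i < n) rel_err (b i 0) (a i 0).

Definition dist_tensor n (B A : tensor n) : \bar R :=
  \big[maxe/-oo%E]_(t : 'I_n * 'I_n * 'I_n)
    rel_err (B t.1.1 t.1.2 t.2) (A t.1.1 t.1.2 t.2).

(* max of z_i / m_i over m_i != 0, as the supremum of a finite set. *)
Definition max_ratio n (z m : 'cV[R]_n) : R :=
  sup [set z i 0 / m i 0 | i in [set i : 'I_n | m i 0 != 0]]%classic.

End Definitions.

(* A directed graph on 'I_n is given by its set T of edges (i, j). *)
Definition edge n (T : {set 'I_n * 'I_n}) : rel 'I_n :=
  fun i j => (i, j) \in T.

Definition uedge n (T : {set 'I_n * 'I_n}) : rel 'I_n :=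
  fun i j => edge T i j || edge T j i.

(* The underlying undirected (multi)graph of T is connected and has no cycle:
   an edge e lies on a cycle iff its ends are connected in T minus e.  In
   particular loops and pairs of antiparallel edges are excluded. *)
Definition spanning_tree n (T : {set 'I_n * 'I_n}) : bool :=
  [forall i, forall j, connect (uedge T) i j] &&
  [forall e in T, ~~ connect (uedge (T :\ e)) e.1 e.2].

(* In a tree, all edges are oriented towards l iff following the directed edges
   leads from every node to l. *)
Definition oriented_towards n (l : 'I_n) (T : {set 'I_n * 'I_n}) : bool :=
  [forall i, connect (edge T) i l].

Section Splitting.
Variable R : realType.

Definition zeta n (M : 'M[R]_n) : 'cV[R]_n :=
  \col_l ((\det M)^-1 *
    \sum_(T : {set 'I_n * 'I_n} | spanning_tree T && oriented_towards l T)
      \prod_(e in T) (- M e.1 e.2)).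

Definition Spart n (M : 'M[R]_n) : 'M[R]_n :=
  invmx M - const_mx 1 *m (zeta M)^T.

End Splitting.

(* Main.v *)
Require Import Defs.
From HB Require Import structures.
From mathcomp Require Import all_boot all_order all_algebra all_fingroup.
From mathcomp Require Import all_classical all_reals.
From mathcomp Require Import complex.
From mathcomp Require Import topology normedtype sequences ring lra.

Set Implicit Arguments.
Unset Strict Implicit.
Unset Printing Implicit Defensive.
Import Order.TTheory GRing.Theory Num.Theory.
Import numFieldNormedType.Exports.
Local Open Scope ring_scope.

(** Write m' = m + h.  Since m = a + B m^2, the perturbed equation becomes
      R' h = b + B' h^2,  where R' = Rmat B' m, b = (a' - a) + (B' - B) m^2.
    The perturbation preserves the column sums of B and the sum of a, so the
    entries of b sum to 0, and those of B' h^2 do when those of h do.  On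
    vectors of sum 0 the inverse of R' acts as S'^T, where S' = Spart R'^T,
    because the other part of the inverse of R'^T is 1 zeta^T.  It remains to
    find a fixed point of
      h |-> S'^T (b + B' h^2)
    in the box |h| <= t m with t = 2 omega gamma eps.

    The key fact is 0 <= S' <= gamma S entrywise ([Spart_perturb]),
    because the entries of S' can be written without subtractions.  Indeed
    R'^T = L + c I,
    where L is the Laplacian of a weighted complete digraph and c = 1 - 2 alpha
    is the same for B and B'.  Adding a root joined to every node by an arc of
    weight c, the matrix-tree theorem ([det_wlap]) expands the determinant and
    the cofactors as sums over maps that send each node to its successor
    ([None] is the root), with nonnegative coefficients ([adj_wlap]).  In the
    (k, l) cofactor the node l points to the root; the maps where no other node
    does are exactly the spanning trees oriented towards l
    ([sum_spanning_trees]), whatever k is.  They make up zeta_l, and S' is what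
    remains.  A relative perturbation eps of the weights thus multiplies the
    numerators of S by at most (1 + eps)^(n-1) and the determinant by at least
    (1 - eps)^n.

    Componentwise, |b| <= eps m and B' m^2 <= (1 + eps) m, and S^T m <= omega m.
    Hence the map sends the box into itself and contracts it, in the sup norm
    weighted by m, by the factor 2 t (1 + eps) gamma omega, which is
    4 (eps + eps^2) gamma^2 omega^2 < 1 ([quadratic_fixpoint]).

    That the entries of m sum to 1, which fixes the row sums c, follows from
    minimality: the iterates of x |-> a + B x^2 from 0 keep a sum at most 1, so
    they converge to a solution of sum at most 1 ([minimal_sum_eq1]). *)

(** * Maps from nodes to successors *)

Section RootedMaps.
Variable n : nat.
Implicit Type f : {ffun 'I_n -> option 'I_n}.

(** [f i] is the successor of the node i, and [None] the root, which [obind f]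
    keeps in place. *)
Definition rooted f : bool :=
  [forall i, fconnect (obind f) (Some i) None].

Lemma fconnect_obind f i :
  fconnect (obind f) (Some i) None = fconnect (obind f) (f i) None.
Proof.
apply/idP/idP => [|h]; last first.
  exact: connect_trans (fconnect1 (obind f) (Some i)) h.
move=> /iter_findex; case: findex => [//|k].
by rewrite iterSr /= => <-; exact: fconnect_iter.
Qed.

(** The number of steps to the root decreases along f.  With the converse below,
    rootedness becomes the existence of a rank, which is easier to transport
    from one map to another than reachability. *)
Lemma rooted_rank f : rooted f ->
  exists d : 'I_n -> nat, forall i j, f i = Some j -> (d j < d i)%N.
Proof.
move=> /forallP rf.
have ex x : exists k, iter k (obind f) x == None.
  case: x => [i|]; last by exists 0%N.
  by exists (findex (obind f) (Some i) None); rewrite (iter_findex (rf i)).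
exists (fun i => ex_minn (ex (Some i))) => i j fi.
case: (ex_minnP (ex (Some j))) => p _ pmin.
case: ex_minnP => -[|q] // /eqP; rewrite iterSr /= fi => e _.
by rewrite ltnS; apply: pmin; apply/eqP.
Qed.

Lemma rank_rooted f (d : 'I_n -> nat) :
  (forall i j, f i = Some j -> (d j < d i)%N) -> rooted f.
Proof.
move=> dP; apply/forallP => i; move: {2}(d i) (leqnn (d i)) => k.
elim: k i => [|k IH] i; rewrite fconnect_obind; case fi: (f i) => [j|] //.
  by move=> h; have := leq_trans (dP _ _ fi) h.
by move=> h; apply: IH; rewrite -ltnS; exact: leq_trans (dP _ _ fi) h.
Qed.

Definition reroute f (l : 'I_n) (o : option 'I_n) :
  {ffun 'I_n -> option 'I_n} :=
  [ffun i => if i == l then o else f i].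

(** A rank that works when l has a successor still works when l points to the
    root. *)
Lemma rooted_reroute_None f l o : rooted (reroute f l o) ->
  rooted (reroute f l None).
Proof.
move=> /rooted_rank[d dP]; apply: (@rank_rooted _ d) => i j.
by have := dP i j; rewrite !ffunE; case: eqP.
Qed.

(** A node of minimal rank has no successor. *)
Lemma rooted_has_root f : (0 < n)%N -> rooted f -> exists i, f i = None.
Proof.
move=> n_gt0 /rooted_rank[d dP].
pose i0 := Ordinal n_gt0.
case: (@arg_minnP _ i0 xpredT d) => // i _ imin.
exists i; case fi: (f i) => [j|] //.
by have := leq_trans (dP _ _ fi) (imin j isT); rewrite ltnn.
Qed.

End RootedMaps.

(** * Spanning trees as successor maps *)

Section Trees.
Variable n : nat.
Implicit Types (f : {ffun 'I_n -> option 'I_n}) (T : {set 'I_n * 'I_n}).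

(** The successor maps whose arcs form a tree oriented towards l: l is then the
    only node that points to the root. *)
Definition arborescence (l : 'I_n) f : bool :=
  [forall i, (f i == None) == (i == l)] && rooted f.

Definition arcs f : {set 'I_n * 'I_n} := [set e | f e.1 == Some e.2].

Definition parent T : {ffun 'I_n -> option 'I_n} :=
  [ffun i => [pick j | (i, j) \in T]].

Lemma arcsK : cancel arcs parent.
Proof.
move=> f; apply/ffunP => i; rewrite ffunE; case: pickP => [j|fi].
  by rewrite inE => /eqP.
by case e: (f i) => [j|] //; have := fi j; rewrite inE e eqxx.
Qed.

Lemma uconnectC T : connect_sym (uedge T).
Proof. by apply: sym_connect_sym => x y; rewrite /uedge orbC. Qed.

Lemma connect_uedge T i j : connect (edge T) i j -> connect (uedge T) i j.
Proof. by apply: connect_sub => x y h; apply: connect1; rewrite /uedge h. Qed.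

Lemma connect_arcs_root l f i : arborescence l f -> connect (edge (arcs f)) i l.
Proof.
case/andP => /forallP fN /rooted_rank[d dP].
move: {2}(d i) (leqnn (d i)) => k.
have next i1 : i1 = l \/ exists2 j, f i1 = Some j & (d j < d i1)%N.
  have := fN i1; case fi: (f i1) => [j|] /=.
    by move=> _; right; exists j => //; exact: dP fi.
  by rewrite eqxx => /eqP/esym/eqP ->; left.
elim: k i => [|k IH] i; case: (next i) => [-> //|[j fi lt]].
  by move=> h; have := leq_trans lt h.
move=> h; apply: (@connect_trans _ _ j); last first.
  by apply: IH; rewrite -ltnS; exact: leq_trans lt h.
by apply: connect1; rewrite /edge inE fi.
Qed.

Lemma rank_connect_arcs f (d : 'I_n -> nat) i j :
  (forall i j, f i = Some j -> (d j < d i)%N) ->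
  connect (edge (arcs f)) i j -> (d j <= d i)%N.
Proof.
move=> dP /connectP[p]; elim: p i => [|x p IH] i /=; first by move=> _ ->.
case/andP; rewrite /edge inE /= => /eqP/dP/ltnW lt /IH h /h h'.
exact: leq_trans h' lt.
Qed.

(** Following successors connects every node to l.  Removing the arc (i, f i)
    isolates the set of nodes from which i is reachable: any other arc has both
    ends in it or none, and f i, of smaller rank than i, is outside. *)
Lemma arborescence_tree l f : arborescence l f ->
  spanning_tree (arcs f) && oriented_towards l (arcs f).
Proof.
move=> fA; have to_l i := connect_arcs_root i fA.
apply/andP; split; last by apply/forallP.
apply/andP; split.
  apply/'forall_forallP => i j.
  apply: (@connect_trans _ _ l); first exact: connect_uedge.
  by rewrite uconnectC; exact: connect_uedge.
apply/'forall_implyP => -[i j]; rewrite inE /= => /eqP fi.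
apply/negP => ij.
have [_ /rooted_rank[d dP]] := andP fA.
pose U := [pred a | connect (edge (arcs f)) a i].
have : fingraph.closed (uedge (arcs f :\ (i, j))) U.
  apply: intro_closed; first exact: uconnectC.
  move=> a b; rewrite /uedge /edge !inE /= !xpair_eqE.
  case/orP => /andP[ne /eqP fab]; last first.
    by move=> h; apply: connect_trans h; apply: connect1; rewrite /edge inE fab.
  case/connectP => -[|c p] /=; first by move=> _ ai; move: ne fab; rewrite -ai
    eqxx fi => /eqP bj [] /esym.
  case/andP; rewrite {1}/edge inE /= fab => /eqP[<-] bp e.
  by apply/connectP; exists p.
move=> /closed_connect/(_ _ _ ij); rewrite !inE /= connect0 => /esym.
move=> /(rank_connect_arcs dP); rewrite leqNgt => /negP; apply.
exact: dP fi.
Qed.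

Lemma path_avoid T i j x p : j \notin p -> path (edge T) x p ->
  path (edge (T :\ (i, j))) x p.
Proof.
elim: p x => //= y p IH x; rewrite in_cons negb_or => /andP[jy jp].
case/andP => xy yp; rewrite IH // andbT /edge in_setD1 xpair_eqE.
by rewrite (eq_sym y) (negPf jy) andbF.
Qed.

(** A simple path from j back to i does not enter j again, hence does not use
    the arc (i, j) and would close a cycle with it. *)
Lemma tree_no_return T i j : spanning_tree T -> (i, j) \in T ->
  ~~ connect (edge T) j i.
Proof.
case/andP => _ /'forall_implyP acyc ijT.
apply: contra (acyc _ ijT) => /= /connectP[p jp ->].
rewrite uconnectC; case/shortenP: jp => q jq /= /andP[jNq _] _.
by apply: connect_uedge; apply/connectP; exists q => //; exact: path_avoid.
Qed.

(** Using an arc out of i requires reaching i first. *)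
Lemma connect_avoid T i j x y : ~~ connect (edge T) x i ->
  connect (edge T) x y -> connect (edge (T :\ (i, j))) x y.
Proof.
move=> xNi /connectP[p]; elim: p x xNi => [|z p IH] x xNi /=.
  by move=> _ ->.
case/andP => xz zp yE.
have zNi : ~~ connect (edge T) z i.
  by apply: contra xNi; apply: connect_trans; exact: connect1.
apply: connect_trans (IH _ zNi zp yE); apply: connect1.
rewrite /edge in_setD1 xpair_eqE; have -> : (x == i) = false; last exact: xz.
by apply: contraNF xNi => /eqP ->; exact: connect0.
Qed.

(** Neither j nor j' reaches i again, so both reach l without the arc (i, j);
    going from i to j' to l and back to j would then give a cycle through
    (i, j). *)
Lemma tree_out_uniq l T i j j' : spanning_tree T -> oriented_towards l T ->
  (i, j) \in T -> (i, j') \in T -> j = j'.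
Proof.
move=> tT /forallP to_l ijT ij'T; apply/eqP/negP => /negP jj'.
have [_ /'forall_implyP acyc] := andP tT.
have /negP[] := acyc _ ijT => /=.
have toD x : (i, x) \in T -> connect (uedge (T :\ (i, j))) x l.
  move=> ixT; apply: connect_uedge; apply: connect_avoid (to_l x).
  exact: tree_no_return ixT.
apply: (@connect_trans _ _ j').
  apply: connect1; apply/orP; left; rewrite /edge in_setD1 ij'T andbT.
  by rewrite xpair_eqE eqxx eq_sym.
apply: (@connect_trans _ _ l); first exact: toD.
by rewrite uconnectC; exact: toD.
Qed.

Lemma tree_arborescence l T : spanning_tree T -> oriented_towards l T ->
  arborescence l (parent T) /\ arcs (parent T) = T.
Proof.
move=> tT oT; have /forallP to_l := oT.
have aT : arcs (parent T) = T.
  apply/setP => -[i j]; rewrite inE /= ffunE; case: pickP => [j'|noj].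
    move=> ij'T; apply/eqP/idP => [[<-] //|ijT].
    by congr Some; exact: (tree_out_uniq tT oT ij'T ijT).
  by rewrite noj; apply/eqP.
split=> //; apply/andP; split; apply/forallP => i.
  rewrite ffunE; apply/eqP; have [->|il] := eqVneq i l.
    by case: pickP => // j ljT; have := tree_no_return tT ljT; rewrite to_l.
  case: pickP => // noj; have /connectP[[|j p] /=] := to_l i.
    by move=> _ li; rewrite li eqxx in il.
  by case/andP; rewrite {1}/edge noj.
have step_l : fconnect (obind (parent T)) (Some l) None.
  apply: connect1; rewrite /= ffunE; case: pickP => // j ljT.
  by have := tree_no_return tT ljT; rewrite to_l.
have /connectP[p] := to_l i; elim: p i => [|j p IH] i /=.
  by move=> _ <-.
case/andP => ij jp lE; apply: connect_trans (IH _ jp lE); apply: connect1.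
by move: ij; rewrite /edge -{1}aT inE.
Qed.

(** A spanning tree oriented towards l and the map that sends each node to its
    parent determine each other. *)
Lemma sum_spanning_trees (R : comNzRingType) (W : 'I_n -> option 'I_n -> R) l :
  \sum_(T : {set 'I_n * 'I_n} | spanning_tree T && oriented_towards l T)
     \prod_(e in T) W e.1 (Some e.2) =
  \sum_(f | arborescence l f) \prod_(i | i != l) W i (f i).
Proof.
rewrite (reindex_onto arcs parent) => [|T /andP[tT oT]]; last first.
  by case: (tree_arborescence tT oT).
apply: eq_big => f.
  rewrite arcsK eqxx andbT; apply/idP/idP => [/andP[tT oT]|].
    by have [] := tree_arborescence tT oT; rewrite arcsK.
  exact: arborescence_tree.
case/andP => /andP[tT oT] /eqP fK; have [] := tree_arborescence tT oT.
rewrite fK => /andP[/forallP fN _] _.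
under eq_bigl do rewrite inE.
rewrite -(pair_big_dep xpredT (fun i j => f i == Some j)
  (fun i j => W i (Some j))) /= [RHS]big_mkcond; apply: eq_bigr => i _.
rewrite -(eqP (fN i)); case: (f i) => [j|] /=; last by rewrite big_pred0.
by apply: big_pred1 => j' /=; rewrite (inj_eq Some_inj) eq_sym.
Qed.

End Trees.

(** * The matrix-tree theorem *)

Section Forest.
Variable R : realFieldType.
Variable n : nat.
Implicit Types (f : {ffun 'I_n -> option 'I_n}) (W : 'I_n -> option 'I_n -> R).

(** Row i of the Laplacian of the single arc from i to o; the column of the root
    is deleted. *)
Definition arc (i : 'I_n) (o : option 'I_n) (j : 'I_n) : R :=
  (i == j)%:R - (o == Some j)%:R.

(** A permutation that contributes to the determinant moves each i to itself or
    to its successor, so it does not increase the rank d; as it preserves the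
    total rank, it is the identity. *)
Lemma det_arc_rooted f : rooted f -> \det (\matrix_(i, j) arc i (f i) j) = 1.
Proof.
move=> /rooted_rank[d dP].
have arcii i : arc i (f i) i = 1.
  by rewrite /arc eqxx; case: eqP => [/dP|]; rewrite ?ltnn ?subr0.
rewrite /determinant (bigD1 1%g) //= odd_perm1 mul1r big1 => [|i _]; last first.
  by rewrite mxE perm1 arcii.
rewrite big1 ?addr0 // => s s1.
have [/existsP[i /eqP h]|] := boolP [exists i, arc i (f i) (s i) == 0].
  by rewrite (bigD1 i) //= mxE h mul0r mulr0.
rewrite negb_exists => /forallP h.
have {}h i : s i = i \/ (d (s i) < d i)%N.
  have := h i; rewrite /arc; case: (eqVneq i (s i)) => [<-|_]; first by left.
  by case: (f i =P _) => [fi|_]; [right; exact: dP fi | rewrite subrr eqxx].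
have le i : true -> (d (s i) <= d i ?= iff (d (s i) == d i))%N.
  by split => //; case: (h i) => [->|/ltnW].
have [_] := leqif_sum le; rewrite [X in _ == X](reindex_inj (@perm_inj _ s)) /=.
rewrite eqxx => /esym/forallP eqd; case/eqP: s1.
apply/permP => i; rewrite perm1.
by case: (h i) => //; rewrite (eqP (eqd i)) ltnn.
Qed.

(** The indicator of the nodes that never reach the root is constant along arcs
    and vanishes on the nodes that point to the root, so the matrix kills it. *)
Lemma det_arc_unrooted f :
  ~~ rooted f -> \det (\matrix_(i, j) arc i (f i) j) = 0.
Proof.
rewrite negb_forall => /existsP[i0 i0P]; rewrite -det_tr.
pose x : 'rV[R]_n := \row_j (~~ fconnect (obind f) (Some j) None)%:R.
apply/eqP/det0P; exists x.
  by apply/negP => /eqP/rowP/(_ i0)/eqP; rewrite !mxE i0P oner_eq0.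
apply/rowP => i; rewrite !mxE.
under eq_bigr do rewrite !mxE /arc mulrBr.
rewrite sumrB (bigD1 i) //= eqxx mulr1 big1 ?addr0; last first.
  by move=> j /negPf; rewrite eq_sym => ->; rewrite mulr0.
rewrite fconnect_obind; case fi: (f i) => [j|].
  rewrite (bigD1 j) //= eqxx mulr1 big1 ?addr0 ?subrr // => k.
  by move=> /negPf kj; rewrite (inj_eq Some_inj) eq_sym kj mulr0.
by rewrite connect0 big1 ?subrr // => k _; rewrite mulr0.
Qed.

Lemma det_arc f : \det (\matrix_(i, j) arc i (f i) j) = (rooted f)%:R.
Proof.
by case: (boolP (rooted f)); [exact: det_arc_rooted | exact: det_arc_unrooted].
Qed.

(** The Laplacian of the digraph with weights W, where the row and the column of
    the root are deleted. *)
Definition wlap W : 'M[R]_n := \matrix_(i, j) \sum_o W i o * arc i o j.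

(** The determinant is linear in each row, and each row is a weighted sum of
    single arcs. *)
Theorem det_wlap W :
  \det (wlap W) =
  \sum_(f : {ffun 'I_n -> option 'I_n}) (\prod_i W i (f i)) * (rooted f)%:R.
Proof.
rewrite /determinant.
under eq_bigr => s _.
  under eq_bigr do rewrite mxE.
  rewrite bigA_distr_bigA mulr_sumr; over.
rewrite exchange_big /=; apply: eq_bigr => f _.
rewrite -det_arc mulr_sumr; apply: eq_bigr => s _.
rewrite big_split /= mulrCA; congr (_ * (_ * _)).
by apply: eq_bigr => i _; rewrite mxE.
Qed.

(** A cofactor along row l is the determinant after row l has been replaced by
    the unit vector e_k, and e_k = e_l - (e_l - e_k) is again a signed sum of
    two arcs out of l: one to the root and one to k. *)
Lemma adj_wlap W k l :
  \adj (wlap W) k l =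
  \sum_(f : {ffun 'I_n -> option 'I_n} | f l == None)
     (\prod_(i | i != l) W i (f i)) *
     ((rooted f)%:R - (rooted (reroute f l (Some k)))%:R).
Proof.
pose W' i o := if i == l then (o == None)%:R - (o == Some k)%:R else W i o.
have rowl j : wlap W' l j = (k == j)%:R.
  rewrite mxE /W' eqxx.
  under eq_bigr do rewrite mulrBl.
  rewrite sumrB (bigD1 None) //= big1 => [|o /negPf->]; last by rewrite mul0r.
  rewrite addr0 mul1r (bigD1 (Some k)) //= big1 => [|o /negPf->]; last first.
    by rewrite mul0r.
  by rewrite addr0 eqxx mul1r /arc subr0 opprB addrC subrK (inj_eq Some_inj).
have -> : \adj (wlap W) k l = \det (wlap W').
  rewrite mxE (expand_det_row _ l) (bigD1 k) //= big1 => [|j /negPf jk].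
    rewrite rowl eqxx mul1r addr0 /cofactor; congr (_ * \det _).
    by apply/matrixP => i j; rewrite !mxE /W' eq_sym (negPf (neq_lift _ _)).
  by rewrite rowl eq_sym jk mul0r.
rewrite det_wlap.
pose F (f : {ffun 'I_n -> option 'I_n}) := \prod_(i | i != l) W i (f i).
transitivity (
  \sum_(f : {ffun 'I_n -> option 'I_n} | f l == None) F f * (rooted f)%:R -
  \sum_(f : {ffun 'I_n -> option 'I_n} | f l == Some k) F f * (rooted f)%:R).
  rewrite [X in _ = X - _]big_mkcond [X in _ = _ - X]big_mkcond -sumrB.
  apply: eq_bigr => f _; rewrite (bigD1 l) //= {1}/W' eqxx.
  have -> : \prod_(i | i != l) W' i (f i) = F f.
    by apply: eq_bigr => i /negPf h; rewrite /W' h.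
  case: (f l) => [j|] /=; last by rewrite subr0 mul1r subr0.
  by rewrite !sub0r -!mulrA mulNr; case: (Some j == Some k);
    rewrite ?mul1r ?mul0r.
rewrite [X in _ - X](reindex_onto (fun f => reroute f l (Some k))
  (fun f => reroute f l None)) /=; last first.
  move=> f /eqP fl; apply/ffunP => i; rewrite !ffunE.
  by case: eqP => // ->; rewrite fl.
rewrite [X in _ - X](eq_bigl
  (fun f : {ffun 'I_n -> option 'I_n} => f l == None)) => [|f].
  rewrite -sumrB; apply: eq_bigr => f _; rewrite mulrBr; congr (_ - _ * _).
  by apply: eq_bigr => i /negPf h; rewrite ffunE h.
rewrite ffunE !eqxx /=; apply/eqP/eqP => [<-|fl]; first by rewrite ffunE eqxx.
by apply/ffunP => i; rewrite !ffunE; case: eqP => // ->.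
Qed.

Lemma wlap_off W i j : i != j -> wlap W i j = - W i (Some j).
Proof.
move=> /negPf ij; rewrite mxE (bigD1 (Some j)) //= big1 => [|o /negPf oj].
  by rewrite /arc ij eqxx sub0r mulrN1 addr0.
by rewrite /arc ij oj subr0 mulr0.
Qed.

(** The map that sends every node straight to the root contributes a positive
    product. *)
Lemma det_wlap_gt0 W : (forall i o, 0 <= W i o) -> (forall i, 0 < W i None) ->
  0 < \det (wlap W).
Proof.
move=> W0 WN; rewrite det_wlap (bigD1 [ffun=> None]) //= ltr_wpDr //.
  by apply: sumr_ge0 => f _; rewrite mulr_ge0 ?ler0n ?prodr_ge0.
have -> : rooted [ffun _ : 'I_n => None].
  by apply: (@rank_rooted _ _ (fun=> 0%N)) => i j; rewrite ffunE.
by rewrite mulr1 prodr_gt0 // => i _; rewrite ffunE.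
Qed.

Lemma det_wlap_ge (r : R) W W' : 0 <= r -> (forall i o, 0 <= W i o) ->
  (forall i o, r * W i o <= W' i o) -> r ^+ n * \det (wlap W) <= \det (wlap W').
Proof.
move=> r0 W0 le; rewrite !det_wlap mulr_sumr; apply: ler_sum => f _.
rewrite mulrA ler_wpM2r ?ler0n // -[n in r ^+ n]card_ord -prodr_const.
by rewrite -big_split /=; apply: ler_prod => i _; rewrite le mulr_ge0.
Qed.

(** The part of the cofactor that vanishes with the weights of the arcs to the
    root; it is the numerator of [Spart]. *)
Definition forest_sum W k l : R :=
  \sum_(f : {ffun 'I_n -> option 'I_n} |
         (f l == None) && [exists i, (i != l) && (f i == None)])
     (\prod_(i | i != l) W i (f i)) *
     ((rooted f)%:R - (rooted (reroute f l (Some k)))%:R).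

(** Rerouting l from the root to k can only destroy rootedness. *)
Lemma reroute_coef_ge0 f k l : f l = None ->
  0 <= (rooted f)%:R - (rooted (reroute f l (Some k)))%:R :> R.
Proof.
move=> fl; rewrite subr_ge0 ler_nat.
case: (boolP (rooted (reroute _ _ _))) => // /rooted_reroute_None.
have -> : reroute f l None = f.
  by apply/ffunP => i; rewrite ffunE; case: eqP => // ->.
by move=> ->.
Qed.

Lemma forest_sum_ge0 W k l : (forall i o, 0 <= W i o) -> 0 <= forest_sum W k l.
Proof.
move=> W0; apply: sumr_ge0 => f /andP[/eqP fl _].
by rewrite mulr_ge0 ?prodr_ge0 ?reroute_coef_ge0.
Qed.

Lemma forest_sum_le (r : R) W W' k l :
  (forall i o, 0 <= W' i o) -> (forall i o, W' i o <= r * W i o) ->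
  forest_sum W' k l <= r ^+ (n - 1) * forest_sum W k l.
Proof.
move=> W0 le; rewrite mulr_sumr; apply: ler_sum => f /andP[/eqP fl _].
rewrite mulrA ler_wpM2r ?reroute_coef_ge0 //.
have -> : r ^+ (n - 1) = \prod_(i : 'I_n | i != l) r.
  by rewrite prodr_const cardC1 card_ord subn1.
by rewrite -big_split /=; apply: ler_prod => i _; rewrite W0 le.
Qed.

(** When l is the only node that points to the root, rerouting it leaves no arc
    to the root, so the coefficient does not depend on k. *)
Lemma adj_wlap_split W k l :
  \adj (wlap W) k l =
  forest_sum W k l + \sum_(f | arborescence l f) \prod_(i | i != l) W i (f i).
Proof.
rewrite adj_wlap (bigID (fun f : {ffun 'I_n -> option 'I_n} =>
  [exists i, (i != l) && (f i == None)])) /=; congr (_ + _).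
rewrite [LHS]big_mkcond [RHS]big_mkcond; apply: eq_bigr => f _.
case: ifPn => [/andP[/eqP fl]|].
  rewrite negb_exists => /forallP fN.
  have {}fN i : (f i == None) = (i == l).
    by have := fN i; have [->|_] := eqVneq i l; [rewrite fl | move/negPf].
  have -> : rooted (reroute f l (Some k)) = false.
    apply/negP => /rooted_has_root[|i]; first exact: leq_ltn_trans (ltn_ord l).
    by rewrite ffunE -fN; case: (f i).
  have -> : arborescence l f = rooted f.
    by rewrite /arborescence; case: forallP => //= -[] i; apply/eqP.
  by case: (rooted f); rewrite subr0 ?mulr1 ?mulr0.
apply: contraNeq; case: ifPn => [|_ /eqP//] /andP[/forallP fN _] _.
rewrite (eqP (fN l)) eqxx negb_exists; apply/forallP => i.
by rewrite (eqP (fN i)) andNb.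
Qed.

End Forest.

Section SpartBounds.
Variable R : realType.
Variable n : nat.
Implicit Types W : 'I_n -> option 'I_n -> R.

(** The trees of [zeta] contain no loop, so they only see the off-diagonal
    entries, which are minus the weights. *)
Lemma zeta_wlap W l : zeta (wlap W) l 0 = (\det (wlap W))^-1 *
  \sum_(f | arborescence l f) \prod_(i | i != l) W i (f i).
Proof.
rewrite mxE -sum_spanning_trees; congr (_ * _).
apply: eq_bigr => T /andP[tT _]; apply: eq_bigr => -[i j] ijT /=.
rewrite wlap_off ?opprK //; apply: contraTneq (tree_no_return tT ijT) => ->.
by rewrite connect0.
Qed.

Lemma Spart_wlap W k l : \det (wlap W) != 0 ->
  Spart (wlap W) k l = forest_sum W k l / \det (wlap W).
Proof.
move=> dW; rewrite !mxE big_ord1 !mxE mul1r -/(zeta (wlap W) l 0).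
have := zeta_wlap W l; rewrite mxE => ->.
rewrite /invmx unitmxE unitfE dW !mxE -mulrBr -/(cofactor _ _ _).
have := adj_wlap_split W k l; rewrite mxE => ->.
by rewrite addrK mulrC.
Qed.

(** Numerator and determinant are sums of products of weights with nonnegative
    coefficients, so relative perturbations of the weights multiply up without
    cancellation: n - 1 factors above, as row l is absent, and n below. *)
Lemma Spart_perturb (e : R) W W' k l : 0 <= e -> e < 1 ->
  (forall i o, 0 <= W i o) -> (forall i, 0 < W i None) ->
  (forall i o, (1 - e) * W i o <= W' i o <= (1 + e) * W i o) ->
  0 <= Spart (wlap W') k l <=
  (1 + e) ^+ (n - 1) / (1 - e) ^+ n * Spart (wlap W) k l.
Proof.
move=> e0 e1 W0 WN le.
have e1' : 0 < 1 - e by rewrite subr_gt0.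
have W'0 i o : 0 <= W' i o.
  by case/andP: (le i o) => h _; apply: le_trans h; rewrite mulr_ge0 // ltW.
have W'N i : 0 < W' i None.
  by case/andP: (le i None) => h _; apply: lt_le_trans h; rewrite mulr_gt0.
have d0 := det_wlap_gt0 W0 WN; have d0' := det_wlap_gt0 W'0 W'N.
rewrite !Spart_wlap ?gt_eqF // divr_ge0 ?forest_sum_ge0 ?(ltW d0') //=.
have leN : forest_sum W' k l <= (1 + e) ^+ (n - 1) * forest_sum W k l.
  by apply: forest_sum_le => // i o; case/andP: (le i o).
have leD : (1 - e) ^+ n * \det (wlap W) <= \det (wlap W').
  by apply: det_wlap_ge => [|//|i o]; [exact: ltW | case/andP: (le i o)].
have -> : (1 + e) ^+ (n - 1) / (1 - e) ^+ n *
    (forest_sum W k l / \det (wlap W)) =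
  ((1 + e) ^+ (n - 1) * forest_sum W k l) / ((1 - e) ^+ n * \det (wlap W)).
  by rewrite invfM mulrACA.
have dd : 0 < (1 - e) ^+ n * \det (wlap W) by rewrite mulr_gt0 // exprn_gt0.
apply: ler_pM; rewrite ?invr_ge0 ?forest_sum_ge0 ?(ltW d0') //.
by rewrite lef_pV2 ?posrE.
Qed.

End SpartBounds.

(** * Quadratic maps and the minimal solution *)

Section Bilinear.
Variable R : realType.
Variable n : nat.
Implicit Types (B : tensor R n) (x y : 'cV[R]_n).

Definition bil B x y : 'cV[R]_n :=
  \col_i \sum_j \sum_k B i j k * x j 0 * y k 0.

Lemma bilDl B x1 x2 y : bil B (x1 + x2) y = bil B x1 y + bil B x2 y.
Proof.
apply/colP => i; rewrite !mxE -big_split; apply: eq_bigr => j _ /=.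
by rewrite -big_split; apply: eq_bigr => k _; rewrite !mxE /= mulrDr mulrDl.
Qed.

Lemma bilDr B x y1 y2 : bil B x (y1 + y2) = bil B x y1 + bil B x y2.
Proof.
apply/colP => i; rewrite !mxE -big_split; apply: eq_bigr => j _ /=.
by rewrite -big_split; apply: eq_bigr => k _; rewrite !mxE /= mulrDr.
Qed.

Lemma bilNl B x y : bil B (- x) y = - bil B x y.
Proof.
apply/colP => i; rewrite !mxE -sumrN; apply: eq_bigr => j _ /=.
by rewrite -sumrN; apply: eq_bigr => k _; rewrite !mxE mulrN mulNr.
Qed.

Lemma bilNr B x y : bil B x (- y) = - bil B x y.
Proof.
apply/colP => i; rewrite !mxE -sumrN; apply: eq_bigr => j _ /=.
by rewrite -sumrN; apply: eq_bigr => k _; rewrite !mxE mulrN.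
Qed.

Lemma bil_le B x x' y y' : nneg_tensor B -> le_vec 0 x -> le_vec 0 y ->
  le_vec x x' -> le_vec y y' -> le_vec (bil B x y) (bil B x' y').
Proof.
move=> B0 x0 y0 xx' yy' i; rewrite !mxE.
apply: ler_sum => j _; apply: ler_sum => k _.
have := x0 j; have := y0 k; rewrite !mxE => yk xj.
by rewrite ler_pM ?mulr_ge0 // ler_wpM2l.
Qed.

Lemma norm_bil_le B x y (X Y : 'cV[R]_n) : nneg_tensor B ->
  (forall i, `|x i 0| <= X i 0) -> (forall i, `|y i 0| <= Y i 0) ->
  forall i, `|bil B x y i 0| <= bil B X Y i 0.
Proof.
move=> B0 xX yY i; rewrite !mxE; apply: le_trans (ler_norm_sum _ _ _) _.
apply: ler_sum => j _; apply: le_trans (ler_norm_sum _ _ _) _.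
apply: ler_sum => k _; rewrite !normrM (ger0_norm (B0 i j k)).
by rewrite ler_pM ?mulr_ge0 // ler_wpM2l.
Qed.

Lemma bilZ B (s t : R) x y : bil B (s *: x) (t *: y) = (s * t) *: bil B x y.
Proof.
apply/colP => i; rewrite !mxE mulr_sumr; apply: eq_bigr => j _.
by rewrite mulr_sumr; apply: eq_bigr => k _; rewrite !mxE; ring.
Qed.

Lemma sum_bil B x y c : (forall j k, \sum_i B i j k = c) ->
  \sum_i bil B x y i 0 = c * (\sum_i x i 0) * (\sum_i y i 0).
Proof.
move=> Bc; under eq_bigr do rewrite mxE.
rewrite exchange_big -mulrA mulr_suml mulr_sumr; apply: eq_bigr => j _ /=.
rewrite exchange_big mulrA mulr_sumr; apply: eq_bigr => k _ /=.
by rewrite -!mulr_suml Bc.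
Qed.

Lemma Rmat_mul B m h : Rmat B m *m h = h - (bil B m h + bil B h m).
Proof.
apply/colP => i; rewrite !mxE.
under eq_bigr do rewrite mxE mulrBl.
rewrite sumrB (bigD1 i) //= eqxx mul1r big1 ?addr0; last first.
  by move=> j /negPf ji; rewrite eq_sym ji mul0r.
congr (_ - _).
under eq_bigr do rewrite mulr_suml.
have -> : \sum_j \sum_k B i j k * m j 0 * h k 0 =
          \sum_j \sum_k B i k j * m k 0 * h j 0 by rewrite exchange_big.
rewrite -big_split; apply: eq_bigr => j _ /=.
by rewrite -big_split; apply: eq_bigr => k _ /=; ring.
Qed.

Local Open Scope classical_set_scope.

Lemma cvg_sum (T : finType) (u : T -> nat -> R) (L : T -> R) :
  (forall i, u i @ \oo --> L i) ->
  (fun k => \sum_i u i k) @ \oo --> \sum_i L i.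
Proof.
by move=> uL; apply: (cvg_big (@add_continuous R)) => i _; exact: uL.
Qed.

Definition coord_cvg (u : nat -> 'cV[R]_n) (L : 'cV[R]_n) :=
  forall i, (fun k => u k i 0) @ \oo --> L i 0.

Lemma coord_cvg_unique u L L' : coord_cvg u L -> coord_cvg u L' -> L = L'.
Proof.
by move=> uL uL'; apply/colP => i; apply: cvg_unique (uL i) (uL' i).
Qed.

Lemma coord_cvg_quadratic (A : 'M[R]_n) b B u L : coord_cvg u L ->
  coord_cvg (fun k => A *m (b + bil B (u k) (u k))) (A *m (b + bil B L L)).
Proof.
move=> uL i.
have -> : (fun k => (A *m (b + bil B (u k) (u k))) i 0) =
  (fun k => \sum_j A i j * (b j 0 +
      \sum_p \sum_q B j p q * u k p 0 * u k q 0)).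
  by apply/funext => k; rewrite !mxE; apply: eq_bigr => j _; rewrite !mxE.
have -> : (A *m (b + bil B L L)) i 0 = \sum_j A i j * (b j 0 +
      \sum_p \sum_q B j p q * L p 0 * L q 0).
  by rewrite !mxE; apply: eq_bigr => j _; rewrite !mxE.
apply: cvg_sum => j; apply: cvgM; first exact: cvg_cst.
apply: cvgD; first exact: cvg_cst.
apply: cvg_sum => p; apply: cvg_sum => q.
by apply: cvgM => //; apply: cvgM => //; exact: cvg_cst.
Qed.

Lemma fixpoint_of_cvg (A : 'M[R]_n) b B u L :
  (forall k, u k.+1 = A *m (b + bil B (u k) (u k))) ->
  coord_cvg u L -> L = A *m (b + bil B L L).
Proof.
move=> uS uL; apply: (@coord_cvg_unique (fun k => u k.+1)).
  by move=> i; rewrite (cvg_shiftS (fun k => u k i 0)).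
have -> : (fun k => u k.+1) = (fun k => A *m (b + bil B (u k) (u k))).
  exact/funext.
exact: coord_cvg_quadratic.
Qed.

End Bilinear.

Section Minimal.
Variable R : realType.
Variable n : nat.
Implicit Types (B : tensor R n) (x y a : 'cV[R]_n).
Local Open Scope classical_set_scope.

(** The sum s of a solution satisfies s = 1 - alpha + alpha s^2, so it is 1 or
    (1 - alpha) / alpha > 1.  The second value is excluded by a solution of sum
    at most 1, the limit of the increasing iterates from 0. *)
Lemma minimal_sum_eq1 a B m alpha : 0 < alpha -> alpha < 1 / 2 ->
  le_vec 0 a -> nneg_tensor B ->
  (forall j k, \sum_i B i j k = alpha) -> \sum_i a i 0 = 1 - alpha ->
  is_minimal_nneg_solution a B m -> \sum_i m i 0 = 1.
Proof.
move=> al0 al12 a0 B0 Bs as_ [m0 ms mmin].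
pose u k := iter k (fun x => a + bil B x x) 0.
have uE k : u k.+1 = a + bil B (u k) (u k) by [].
have u0 k : le_vec 0 (u k).
  elim: k => [|k IH] i; first exact: lexx.
  rewrite uE; have := a0 i; rewrite !mxE => ai; apply: addr_ge0 => //.
  apply: sumr_ge0 => p _; apply: sumr_ge0 => q _.
  have := IH p; have := IH q; rewrite !mxE => uq up.
  by rewrite !mulr_ge0 //; exact: B0.
have uinc k : le_vec (u k) (u k.+1).
  elim: k => [|k IH]; first exact: u0.
  by rewrite [u k.+2]uE [in X in le_vec X]uE => i; rewrite !mxE lerD2l;
    have := bil_le B0 (u0 k) (u0 k) IH IH i; rewrite !mxE.
have usum k : \sum_i u k i 0 <= 1.
  elim: k => [|k IH]; first by rewrite big1 // => i _; rewrite mxE.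
  rewrite uE; under eq_bigr do rewrite mxE.
  rewrite big_split /= as_ (sum_bil _ _ Bs).
  have : 0 <= \sum_i u k i 0.
    by apply: sumr_ge0 => i _; have := u0 k i; rewrite mxE.
  set s := \sum_i _ in IH * => s0.
  have ss1 : s * s <= 1 by rewrite mulr_ile1.
  have : alpha * (s * s) <= alpha * 1 by rewrite ler_wpM2l // ltW.
  by lra.
have ucvg i : cvgn (fun k => u k i 0).
  apply: nondecreasing_is_cvgn.
    by apply/nondecreasing_seqP => k; exact: uinc.
  exists 1 => _ [k _ <-]; apply: le_trans (usum k).
  rewrite (bigD1 i) //= lerDl; apply: sumr_ge0 => j _.
  by have := u0 k j; rewrite mxE.
pose L : 'cV[R]_n := \col_i limn (fun k => u k i 0).
have uL : coord_cvg u L by move=> i; rewrite mxE; exact: ucvg.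
have Lfix : L = a + bil B L L.
  rewrite -[RHS]mul1mx; apply: (fixpoint_of_cvg _ uL) => k.
  by rewrite uE mul1mx.
have L0 : le_vec 0 L.
  move=> i; rewrite [X in X <= _]mxE; apply: (cvgr_to_ge (uL i)).
  by apply: nearW => k; have := u0 k i; rewrite mxE.
have Ls : \sum_i L i 0 <= 1.
  by apply: (cvgr_to_le (cvg_sum uL)); apply: nearW.
have mL : \sum_i m i 0 <= 1.
  by apply: le_trans Ls; apply: ler_sum => i _; exact: mmin.
have : \sum_i m i 0 = 1 - alpha + alpha * (\sum_i m i 0) * (\sum_i m i 0).
  rewrite {1}ms -as_ -(sum_bil _ _ Bs) -big_split /=; apply: eq_bigr => i _.
  by rewrite !mxE.
set s := \sum_i _ in mL * => sE.
have : (s - 1) * (alpha * s - (1 - alpha)) = 0 by move: sE; clear; lra.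
move/eqP; rewrite mulf_eq0 !subr_eq0 => /orP[/eqP//|/eqP h].
have : alpha * s <= alpha * 1 by rewrite ler_wpM2l // ltW.
by lra.
Qed.

End Minimal.

(** * A weighted contraction *)

Section Contraction.
Variable R : realType.
Variable n : nat.
Implicit Types (B : tensor R n) (x y b m h : 'cV[R]_n) (A : 'M[R]_n).
Local Open Scope classical_set_scope.

Lemma cvgn_geometric_steps (x : nat -> R) (C q : R) : 0 <= q -> q < 1 ->
  (forall k, `|x k.+1 - x k| <= C * q ^+ k) -> cvgn x.
Proof.
move=> q0 q1 xC.
have -> : x = (fun k => x 0%N + series (telescope x) k).
  by apply/funext => k; exact: eq_sum_telescope.
apply: is_cvgD; first exact: is_cvg_cst.
apply: normed_cvg; apply: (@series_le_cvg _ _ (geometric C q)) => //.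
- by move=> k; exact: normr_ge0.
- by move=> k; apply: (le_trans (normr_ge0 _) (xC k)).
- by apply: is_cvg_geometric_series; rewrite ger0_norm.
Qed.

Lemma norm_mulmx_le A x (X : 'cV[R]_n) : (forall i j, 0 <= A i j) ->
  (forall i, `|x i 0| <= X i 0) -> forall i, `|(A *m x) i 0| <= (A *m X) i 0.
Proof.
move=> A0 xX i; rewrite !mxE; apply: le_trans (ler_norm_sum _ _ _) _.
by apply: ler_sum => j _; rewrite normrM (ger0_norm (A0 i j)) ler_wpM2l.
Qed.

(** In the sup norm weighted by m, the bilinear map A B has norm at most kappa as
    soon as it satisfies this bound at (m, m). *)
Lemma norm_mulmx_bil_le A B m (kappa s t : R) x y :
  (forall i j, 0 <= A i j) -> nneg_tensor B -> 0 <= s -> 0 <= t ->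
  (forall i, (A *m bil B m m) i 0 <= kappa * m i 0) ->
  (forall i, `|x i 0| <= s * m i 0) -> (forall i, `|y i 0| <= t * m i 0) ->
  forall i, `|(A *m bil B x y) i 0| <= s * t * (kappa * m i 0).
Proof.
move=> A0 B0 s0 t0 Am xs yt i.
have st : forall j, `|bil B x y j 0| <= ((s * t) *: bil B m m) j 0.
  by rewrite -bilZ; apply: norm_bil_le => // j; rewrite mxE.
apply: le_trans (norm_mulmx_le A0 st i) _.
by rewrite -scalemxAr mxE ler_wpM2l // mulr_ge0.
Qed.

(** The iterates from 0 stay in the box |h| <= t m.  There the quadratic map is
    Lipschitz with constant 2 kappa t, because h^2 - g^2 = (h - g) h + g (h - g),
    so they converge geometrically. *)
Lemma quadratic_fixpoint A b B m (kappa t : R) :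
  (forall i j, 0 <= A i j) -> nneg_tensor B -> le_vec 0 m -> 0 <= t ->
  0 <= kappa -> 2 * kappa * t < 1 ->
  (forall i, (A *m bil B m m) i 0 <= kappa * m i 0) ->
  (forall i, `|(A *m b) i 0| + t * t * (kappa * m i 0) <= t * m i 0) ->
  (forall x, \sum_i x i 0 = 0 -> \sum_i (A *m (b + bil B x x)) i 0 = 0) ->
  exists h, [/\ h = A *m (b + bil B h h),
    forall i, `|h i 0| <= t * m i 0 & \sum_i h i 0 = 0].
Proof.
move=> A0 B0 m0 t0 kp0 q1 Am Ab sum0.
pose u k := iter k (fun x => A *m (b + bil B x x)) 0.
have ut k i : `|u k i 0| <= t * m i 0.
  elim: k i => [|k IH] i.
    by have := m0 i; rewrite !mxE normr0 => ?; rewrite mulr_ge0.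
  apply: le_trans (Ab i); rewrite /= mulmxDr mxE.
  apply: le_trans (ler_normD _ _) _; rewrite lerD2l.
  exact: (norm_mulmx_bil_le A0 B0 t0 t0 Am IH IH).
have usum k : \sum_i u k i 0 = 0.
  elim: k => [|k IH]; last exact: sum0.
  by rewrite big1 // => i _; rewrite mxE.
set q := 2 * kappa * t in q1.
have q0 : 0 <= q by rewrite !mulr_ge0.
have ud k i : `|(u k.+1 - u k) i 0| <= q ^+ k * t * m i 0.
  elim: k i => [|k IH] i; first by rewrite expr0 mul1r subr0; exact: (ut 1%N).
  have -> : u k.+2 - u k.+1 =
      A *m bil B (u k.+1 - u k) (u k.+1) + A *m bil B (u k) (u k.+1 - u k).
    rewrite [u k.+2]/= [X in _ - X]/= -mulmxBr -mulmxDr; congr (A *m _).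
    rewrite bilDl bilNl bilDr bilNr -/(u k) -/(u k.+1).
    by rewrite addrA subrK opprD addrACA subrr add0r.
  rewrite mxE; apply: le_trans (ler_normD _ _) _.
  have qt0 : 0 <= q ^+ k * t by rewrite mulr_ge0 ?exprn_ge0.
  have h1 := norm_mulmx_bil_le A0 B0 qt0 t0 Am IH (ut k.+1) i.
  have h2 := norm_mulmx_bil_le A0 B0 t0 qt0 Am (ut k) IH i.
  apply: le_trans (lerD h1 h2) _; rewrite exprS /q le_eqVlt; apply/orP; left.
  by apply/eqP; ring.
have ucvg i : cvgn (fun k => u k i 0).
  apply: (@cvgn_geometric_steps _ (t * m i 0) q) => // k.
  have := ud k i; rewrite !mxE => /le_trans; apply.
  by rewrite -mulrA mulrC.
pose h : 'cV[R]_n := \col_i limn (fun k => u k i 0).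
have uh : coord_cvg u h by move=> i; rewrite mxE; exact: ucvg.
exists h; split.
- exact: (fixpoint_of_cvg _ uh).
- move=> i; apply: (cvgr_to_le (cvg_norm (uh i))).
  by apply: nearW => k; exact: ut.
- apply: (@cvg_unique _ _ _ _ _ _ (cvg_sum uh)) => //.
  rewrite (_ : (fun k => _) = (fun=> 0)); first exact: cvg_cst.
  by apply/funext => k; exact: usum.
Qed.

End Contraction.

(** * Relative distances *)

Section Ratios.
Variable R : realType.

Lemma rel_err_leP (b a e : R) : 0 <= a -> (rel_err b a <= e%:E)%E ->
  `|b - a| <= e * a.
Proof.
move=> a0; rewrite /rel_err inver normr_eq0; case: eqVneq => [->|an].
  rewrite subr0 mulr0; have [->|bn] := eqVneq b 0; first by rewrite normr0.
  by rewrite gt0_muley ?lte_fin ?normr_gt0.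
by rewrite -EFinM lee_fin (ger0_norm a0) ler_pdivrMr // lt_neqAle eq_sym an.
Qed.

Lemma dist_vec_leP n (b a : 'cV[R]_n) e : le_vec 0 a ->
  (dist_vec b a <= e%:E)%E -> forall i, `|b i 0 - a i 0| <= e * a i 0.
Proof.
move=> a0 h i; apply: rel_err_leP; first by have := a0 i; rewrite mxE.
by apply: le_trans h; exact: le_bigmax.
Qed.

Lemma dist_tensor_leP n (B A : tensor R n) e : nneg_tensor A ->
  (dist_tensor B A <= e%:E)%E ->
  forall i j k, `|B i j k - A i j k| <= e * A i j k.
Proof.
move=> A0 h i j k; apply: rel_err_leP => //; apply: le_trans h.
exact: (@le_bigmax _ _ _ _ (fun t : 'I_n * 'I_n * 'I_n =>
  rel_err (B t.1.1 t.1.2 t.2) (A t.1.1 t.1.2 t.2)) (i, j, k)).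
Qed.

Lemma le_dist_vec n (b a : 'cV[R]_n) e : lt_vec 0 a ->
  (forall i, `|b i 0 - a i 0| <= e * a i 0) -> (dist_vec b a <= e%:E)%E.
Proof.
move=> a0 h; apply/bigmax_leP; split; first exact: leNye.
move=> i _; have := a0 i; rewrite mxE => ai.
rewrite /rel_err inver normr_eq0 gt_eqF // -EFinM lee_fin (gtr0_norm ai).
by rewrite ler_pdivrMr.
Qed.

Lemma le_max_ratio n (z m : 'cV[R]_n) i : 0 < m i 0 ->
  z i 0 <= max_ratio z m * m i 0.
Proof.
move=> mi; rewrite -ler_pdivrMr //; apply: ub_le_sup; last first.
  by exists i => //=; rewrite gt_eqF.
exists (\sum_j `|z j 0 / m j 0|) => _ [j _ <-].
rewrite (bigD1 j) //=; apply: le_trans (ler_norm _) _.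
by rewrite lerDl sumr_ge0.
Qed.

End Ratios.

(** * The weights of the linearised equation *)

Section RmatTree.
Variable R : realType.
Variable n : nat.
Implicit Types (B : tensor R n) (m : 'cV[R]_n).

(** The weights for which [wlap] is the transpose of [Rmat]: the rows of [wlap]
    sum to c, the common weight of the arcs to the root. *)
Definition Rweight (c : R) B m (i : 'I_n) (o : option 'I_n) : R :=
  if o is Some j then \sum_k (B j k i + B j i k) * m k 0 else c.

Lemma sum_Rweight alpha B m i : (forall j k, \sum_i B i j k = alpha) ->
  \sum_i m i 0 = 1 -> \sum_o Rweight (1 - 2 * alpha) B m i o = 1.
Proof.
move=> Bs m1; rewrite (bigD1 None) //= (reindex_omap Some id) => [|[]//] /=.
under eq_bigl do rewrite eqxx.
rewrite exchange_big /= (eq_bigr (fun k => 2 * alpha * m k 0)) => [|k _].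
  by rewrite -mulr_sumr m1; ring.
by rewrite -mulr_suml big_split /= !Bs; ring.
Qed.

Lemma Rmat_wlap alpha B m : (forall j k, \sum_i B i j k = alpha) ->
  \sum_i m i 0 = 1 ->
  (Rmat B m)^T = wlap (Rweight (1 - 2 * alpha) B m).
Proof.
move=> Bs m1; apply/matrixP => i j; rewrite !mxE.
under [RHS]eq_bigr do rewrite /arc mulrBr.
rewrite sumrB -mulr_suml (sum_Rweight _ Bs m1) mul1r eq_sym; congr (_ - _).
rewrite [RHS](bigD1 (Some j)) //= eqxx mulr1 [X in _ + X]big1 ?addr0 // => o.
by move=> /negPf->; rewrite mulr0.
Qed.

Lemma Rweight_ge0 c B m i o : 0 <= c -> nneg_tensor B -> le_vec 0 m ->
  0 <= Rweight c B m i o.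
Proof.
move=> c0 B0 m0; case: o => //= j; apply: sumr_ge0 => k _.
have := m0 k; rewrite mxE => mk; rewrite mulr_ge0 // addr_ge0 //; exact: B0.
Qed.

(** The arcs to the root keep their weight c, and the other weights are
    nonnegative combinations of entries of B. *)
Lemma Rweight_perturb c B B' m e i o : 0 <= c -> 0 <= e ->
  le_vec 0 m -> (forall i j k, `|B' i j k - B i j k| <= e * B i j k) ->
  (1 - e) * Rweight c B m i o <= Rweight c B' m i o <=
  (1 + e) * Rweight c B m i o.
Proof.
move=> c0 e0 m0 dB; case: o => [j|] /=; last by nra.
have m0' k : 0 <= m k 0 by have := m0 k; rewrite mxE.
rewrite !mulr_sumr; apply/andP; split; apply: ler_sum => k _;
  rewrite mulrA ler_wpM2r //; have := dB j k i; have := dB j i k;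
  rewrite !ler_norml; lra.
Qed.

End RmatTree.

(** * Existence of the perturbed solution *)

(** For y = 0 the right-hand side is infinite and the product is 0. *)
Lemma lt_inv_mul (R : realType) (x y : R) : 0 <= y ->
  (x%:E < 1%:E / y%:E)%E -> x * y < 1.
Proof.
rewrite le_eqVlt => /predU1P[<- _|y0]; first by rewrite mulr0.
by rewrite inver gt_eqF // -EFinM lte_fin ltr_pdivlMr.
Qed.

Lemma sum_mulmx_Rmat (R : realType) n (alpha : R) (B : tensor R n)
    (m x : 'cV[R]_n) :
  (forall j k, \sum_i B i j k = alpha) -> \sum_i m i 0 = 1 ->
  \sum_i (Rmat B m *m x) i 0 = (1 - 2 * alpha) * \sum_i x i 0.
Proof.
move=> Bs m1; rewrite Rmat_mul.
have E i : (x - (bil B m x + bil B x m)) i 0 =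
    x i 0 - (bil B m x i 0 + bil B x m i 0) by rewrite !mxE.
under eq_bigr do rewrite E.
by rewrite sumrB big_split /= !(sum_bil _ _ Bs) m1; ring.
Qed.

(** [Spart M] differs from the inverse by a matrix with constant columns. *)
Lemma Spart_mul_sum0 (R : realType) n (M : 'M[R]_n)
    (y : 'cV[R]_n) : \sum_i y i 0 = 0 ->
  (Spart M)^T *m y = (invmx M)^T *m y.
Proof.
move=> y0; rewrite /Spart linearB /= mulmxBl trmx_mul trmxK -mulmxA.
have -> : (const_mx 1)^T *m y = 0 :> 'M_1.
  apply/matrixP => i j; rewrite !ord1 !mxE -[RHS]y0; apply: eq_bigr => k _.
  by rewrite !mxE mul1r.
by rewrite mulmx0 subr0.
Qed.

Theorem theorem4p4 (R : realType) (n : nat) (alpha : R)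
    (alpha_gt0 : 0 < alpha) (alpha_lt : alpha < 1 / 2)
    (v : 'cV[R]_n) (v_stoch : stochastic_vector v)
    (P : tensor R n) (P_stoch : stochastic_tensor P) :
  let a : 'cV[R]_n := (1 - alpha) *: v in
  let B : tensor R n := scale_tensor alpha P in
  forall (m : 'cV[R]_n)
    (m_min : is_minimal_nneg_solution a B m) (m_gt0 : lt_vec 0 m)
    (B' : tensor R n) (B'_ge0 : nneg_tensor B')
    (a' : 'cV[R]_n) (a'_ge0 : le_vec 0 a')
    (B'_sum : forall j k, \sum_i B' i j k = \sum_i B i j k)
    (a'_sum : \sum_i a' i 0 = \sum_i a i 0)
    (eps : R) (eps_gt0 : 0 < eps) (eps_lt1 : eps < 1)
    (dB : (dist_tensor B' B <= eps%:E)%E) (da : (dist_vec a' a <= eps%:E)%E),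
  let gamma : R := (1 + eps) ^+ (n - 1) / (1 - eps) ^+ n in
  let S : 'M[R]_n := Spart (Rmat B m)^T in
  let z : 'cV[R]_n := S^T *m m in
  let omega : R := max_ratio z m in
  forall (eps_rho : (1 + eps) * spectral_radius (1%:M - Rmat B m) < 1)
    (* division in \bar R: the bound is +oo when omega = 0 *)
    (eps_small : ((eps + eps ^+ 2)%:E
                    < 1%:E / (4 * gamma ^+ 2 * omega ^+ 2)%:E)%E),
  exists m' : 'cV[R]_n,
    is_solution a' B' m' /\
    (dist_vec m' m <= (2 * omega * gamma * eps)%:E)%E.
Proof.
move=> a B m m_min m_gt0 B' B'0 a' a'0 B's a's eps e0 e1 dB da.
move=> gamma S z omega _ esmall.
have [v0 v1] := v_stoch; have [P0 P1] := P_stoch.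
have al0 := ltW alpha_gt0.
have B0 : nneg_tensor B by move=> i j k; rewrite mulr_ge0.
have Bs j k : \sum_i B i j k = alpha by rewrite -mulr_sumr P1 mulr1.
have {}B's j k : \sum_i B' i j k = alpha by rewrite B's Bs.
have a0 : le_vec 0 a.
  move=> i; have := v0 i; rewrite !mxE => vi; apply: mulr_ge0 => //.
  by move: alpha_lt; lra.
have as1 : \sum_i a i 0 = 1 - alpha.
  by under eq_bigr do rewrite mxE; rewrite -mulr_sumr v1 mulr1.
clearbody a B.
have m1 := minimal_sum_eq1 alpha_gt0 alpha_lt a0 B0 Bs as1 m_min.
have [m0 ms _] := m_min.
have mi i : 0 < m i 0 by have := m_gt0 i; rewrite mxE.
have dB' := dist_tensor_leP B0 dB; have da' := dist_vec_leP a0 da.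
have c0 : 0 < 1 - 2 * alpha by move: alpha_lt; lra.
pose W := Rweight (1 - 2 * alpha) B m; pose W' := Rweight (1 - 2 * alpha) B' m.
have W0 i o : 0 <= W i o by apply: Rweight_ge0 => //; exact: ltW.
have WN i : 0 < W i None by [].
have le i o : (1 - eps) * W i o <= W' i o <= (1 + eps) * W i o.
  by apply: Rweight_perturb => //; exact: ltW.
pose A : 'M[R]_n := (Spart (Rmat B' m)^T)^T.
have AS i j : 0 <= A i j <= gamma * S^T i j.
  rewrite /A /S (Rmat_wlap B's m1) (Rmat_wlap Bs m1) [X in 0 <= X <= _]mxE.
  by rewrite [X in _ <= gamma * X]mxE; apply: Spart_perturb => //; exact: ltW.
have A0 i j : 0 <= A i j by case/andP: (AS i j).
have g0 : 0 < gamma by rewrite divr_gt0 // exprn_gt0 //; move: e0 e1; lra.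
have zm i : z i 0 <= omega * m i 0 by exact: le_max_ratio.
clearbody gamma omega.
have Az i : (A *m m) i 0 <= gamma * z i 0.
  rewrite /z !mxE mulr_sumr; apply: ler_sum => j _; rewrite mulrA.
  by rewrite ler_wpM2r ?(ltW (mi _)) //; case/andP: (AS i j).
have Am i : (A *m m) i 0 <= gamma * omega * m i 0.
  by apply: le_trans (Az i) _; rewrite -mulrA ler_wpM2l ?(ltW g0).
have om0 : 0 <= omega.
  have [i _] : exists i : 'I_n, true.
    case: (pickP (xpredT : pred 'I_n)) => [i _|no]; first by exists i.
    by move: m1; rewrite big_pred0 // => /esym/eqP; rewrite oner_eq0.
  have : 0 <= (A *m m) i 0.
    by rewrite mxE; apply: sumr_ge0 => j _; rewrite mulr_ge0 // ltW.
  by move=> /le_trans/(_ (Am i)); rewrite pmulr_lge0 // pmulr_rge0.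
(* The defect of m in the perturbed equation: a' + B' m^2 - m. *)
pose b : 'cV[R]_n := (a' - a) + (bil B' m m - bil B m m).
have dbil i : `|bil B' m m i 0 - bil B m m i 0| <= eps * bil B m m i 0.
  rewrite !mxE -sumrB mulr_sumr; apply: le_trans (ler_norm_sum _ _ _) _.
  apply: ler_sum => j _; rewrite -sumrB mulr_sumr.
  apply: le_trans (ler_norm_sum _ _ _) _; apply: ler_sum => k _.
  rewrite -!mulrBl !normrM (gtr0_norm (mi j)) (gtr0_norm (mi k)) !mulrA.
  by rewrite ler_wpM2r ?(ltW (mi k)) // ler_wpM2r ?(ltW (mi j)) // dB'.
have msi i : m i 0 = a i 0 + bil B m m i 0 by rewrite {1}ms mxE.
have bm i : `|b i 0| <= (eps *: m) i 0.
  have -> : b i 0 = (a' i 0 - a i 0) + (bil B' m m i 0 - bil B m m i 0).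
    by rewrite !mxE.
  rewrite [X in _ <= X]mxE msi mulrDr.
  by apply: le_trans (ler_normD _ _) _; apply: lerD.
have B'm i : `|bil B' m m i 0| <= ((1 + eps) *: m) i 0.
  rewrite -[bil B' m m i 0](subrK (bil B m m i 0)) [X in _ <= X]mxE.
  apply: le_trans (ler_normD _ _) _.
  have bil0 : 0 <= bil B m m i 0.
    rewrite mxE; apply: sumr_ge0 => j _; apply: sumr_ge0 => k _.
    by rewrite !mulr_ge0 ?(ltW (mi _)).
  have ai : 0 <= a i 0 by have := a0 i; rewrite mxE.
  rewrite (ger0_norm bil0); apply: le_trans (lerD (dbil i) (lexx _)) _.
  by rewrite msi; move: e0; nra.
(* The box is twice the first-order bound gamma omega eps, which leaves as much
   room for the quadratic term. *)
pose t := 2 * omega * gamma * eps.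
pose kappa := (1 + eps) * (gamma * omega).
have small : (eps + eps ^+ 2) * (4 * gamma ^+ 2 * omega ^+ 2) < 1.
  apply: lt_inv_mul esmall.
  have -> : 4 * gamma ^+ 2 * omega ^+ 2 = (2 * gamma * omega) ^+ 2 by ring.
  exact: sqr_ge0.
have bsum (x : 'cV[R]_n) : \sum_i x i 0 = 0 -> \sum_i (b + bil B' x x) i 0 = 0.
  move=> x0; have E i : (b + bil B' x x) i 0 = (a' i 0 - a i 0) +
      (bil B' m m i 0 - bil B m m i 0) + bil B' x x i 0 by rewrite !mxE.
  under eq_bigr do rewrite E.
  rewrite !big_split /= !sumrN !(sum_bil _ _ B's) (sum_bil _ _ Bs) a's x0.
  by ring.
have uM : Rmat B' m \in unitmx.
  rewrite -unitmx_tr (Rmat_wlap B's m1) unitmxE unitfE gt_eqF //.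
  apply: det_wlap_gt0 => [i o|i]; last exact: c0.
  by apply: Rweight_ge0 => //; exact: ltW.
have RA (y : 'cV[R]_n) : \sum_i y i 0 = 0 -> Rmat B' m *m (A *m y) = y.
  by move=> y0; rewrite /A Spart_mul_sum0 // trmx_inv trmxK mulKVmx.
have Asum (y : 'cV[R]_n) : \sum_i y i 0 = 0 -> \sum_i (A *m y) i 0 = 0.
  move=> y0; have := sum_mulmx_Rmat (A *m y) B's m1.
  by rewrite RA // y0 => /esym/eqP; rewrite mulf_eq0 gt_eqF //= => /eqP.
have t0 : 0 <= t by rewrite /t !mulr_ge0 // ltW.
have kp0 : 0 <= kappa.
  by rewrite /kappa !mulr_ge0 ?(ltW g0) //; move: e0; lra.
have [h [hfix ht hsum]] : exists h, [/\ h = A *m (b + bil B' h h),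
    forall i, `|h i 0| <= t * m i 0 & \sum_i h i 0 = 0].
  apply: (@quadratic_fixpoint _ _ A b B' m kappa t) => //.
  - by apply: le_lt_trans small; rewrite le_eqVlt /kappa /t; apply/orP; left;
      apply/eqP; ring.
  - move=> i; apply: le_trans (ler_norm _) _.
    apply: le_trans (norm_mulmx_le A0 B'm i) _.
    rewrite -scalemxAr mxE /kappa -mulrA ler_wpM2l //.
    by move: e0; lra.
  - move=> i.
    have h1 : `|(A *m b) i 0| <= eps * (gamma * omega * m i 0).
      apply: le_trans (norm_mulmx_le A0 bm i) _.
      by rewrite -scalemxAr mxE ler_wpM2l // ltW.
    apply: le_trans (lerD h1 (lexx _)) _.
    have -> : eps * (gamma * omega * m i 0) + t * t * (kappa * m i 0) =
       eps * gamma * omega * m i 0 *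
         (1 + (eps + eps ^+ 2) * (4 * gamma ^+ 2 * omega ^+ 2)).
      by rewrite /kappa /t; ring.
    have -> : t * m i 0 = eps * gamma * omega * m i 0 * 2 by rewrite /t; ring.
    apply: ler_wpM2l; first by rewrite !mulr_ge0 // ltW.
    by move: small; lra.
  - by move=> x x0; apply: Asum; exact: bsum.
exists (m + h); split.
  have := RA _ (bsum _ hsum); rewrite -hfix Rmat_mul => hE.
  rewrite /is_solution -/(bil B' (m + h) (m + h)).
  have -> : tensor_sq B' (m + h) = bil B' (m + h) (m + h) by [].
  rewrite !bilDl !bilDr.
  rewrite -[h in LHS](subrK (bil B' m h + bil B' h m)) hE {1}ms /b.
  have -> : tensor_sq B m = bil B m m by [].
  apply/colP => i; rewrite !mxE; ring.
apply: le_dist_vec => // i; rewrite mxE addrAC subrr add0r.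
exact: ht.
Qed.
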